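(* Let $C_1,\ldots,C_r$ be cyclic $2$-groups generated by $x_1,\ldots,x_r$, respectively, where $2^{\alpha_i}$ is the order of $x_i$, and assume that $1\leq \alpha_1\leq\cdots\leq \alpha_r$. Let $G$ be the $2$-nilpotent product of $C_1,\ldots,C_r$. Then $G$ is capable if and only if $r>1$ and $\alpha_r \leq \alpha_{r-1}+1$.
   Context: A group $G$ is capable if there exists a group $H$ with $G\cong H/Z(H)$, where $Z(H)$ is the center of $H$. The lower central series of a group $F$ is $F_1=F$, $F_{n+1}=[F_n,F]$. For groups $A_1,\ldots,A_n$ nilpotent of class at most $2$, their $2$-nilpotent product is $F/F_{3}$, where $F=A_1*\cdots*A_n$ is the free product. *)

(* Defs.v *)
From HB Require Import structures.
From mathcomp Require Import all_boot.
From mathcomp Require Import boolp classical_sets.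

Set Implicit Arguments.
Unset Strict Implicit.
Unset Printing Implicit Defensive.

Local Open Scope group_scope.
Local Open Scope classical_set_scope.
Local Open Scope quotient_scope.

(* MathComp's subgroup theory ({group gT}, 'Z(G), 'L_n(G), G / H) lives inside
   a finite group.  Free products are infinite, and the group H in the
   definition of capability may be, so the notions below are developed for
   an arbitrary groupType, with subgroups as classical sets. *)

Definition subgroup (G : groupType) (S : set G) : Prop :=
  [/\ S 1, forall x y, S x -> S y -> S (x * y) & forall x, S x -> S x^-1].

Definition generated (G : groupType) (A : set G) : set G :=
  smallest (@subgroup G) A.

Definition commutator_subgroup (G : groupType) (A B : set G) : set G :=
  generated [set [~ a, b] | a in A & b in B].

Record normal_subgroup (G : groupType) := NormalSubgroup {
  normal_set :> set G;
  normal_subgroupP : subgroup normal_set;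
  normal_conj : forall x y, normal_set x -> normal_set (x ^ y)
}.

Section QuotientGroup.
Variables (G : groupType) (N : normal_subgroup G).

Definition coset_rel (x y : G) : bool := `[< normal_set N (x^-1 * y) >].

Fact coset_rel_refl : reflexive coset_rel.
Proof. by move=> x; apply/asboolP; rewrite mulVg; case: (normal_subgroupP N). Qed.

Fact coset_rel_sym : symmetric coset_rel.
Proof.
move=> x y; have [_ _ NV] := normal_subgroupP N.
by apply/asboolP/asboolP => /NV; rewrite invgM invgK.
Qed.

Fact coset_rel_trans : transitive coset_rel.
Proof.
move=> y x z /asboolP xy /asboolP yz; apply/asboolP.
have [_ NM _] := normal_subgroupP N.
by move: (NM _ _ xy yz); rewrite -mulgA mulVKg.
Qed.

Canonical coset_equiv :=
  EquivRel coset_rel coset_rel_refl coset_rel_sym coset_rel_trans.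

Definition quotient_group : Type := {eq_quot coset_equiv}.
HB.instance Definition _ := Choice.on quotient_group.
HB.instance Definition _ := EqQuotient.on quotient_group.

Definition quotient_mul (u v : quotient_group) : quotient_group :=
  \pi_quotient_group (repr u * repr v).
Definition quotient_inv (u : quotient_group) : quotient_group :=
  \pi_quotient_group (repr u)^-1.
Definition quotient_one : quotient_group := \pi_quotient_group 1.

Fact coset_repr (x : G) :
  normal_set N ((repr (\pi_quotient_group x))^-1 * x).
Proof. by apply/asboolP/(@eqmodP _ coset_equiv); rewrite reprK. Qed.

Fact quotient_mulE (x y : G) :
  quotient_mul (\pi_quotient_group x) (\pi_quotient_group y)
  = \pi_quotient_group (x * y).
Proof.
apply/eqmodP/asboolP; have [_ NM _] := normal_subgroupP N.
set x' := repr _; set y' := repr _.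
have := NM _ _ (normal_conj y' (coset_repr x)) (coset_repr y).
by rewrite -/x' -/y' /conjg invgM !mulgA mulgK.
Qed.

Fact quotient_invE (x : G) :
  quotient_inv (\pi_quotient_group x) = \pi_quotient_group x^-1.
Proof.
apply/eqmodP/asboolP; have [_ _ NV] := normal_subgroupP N.
set x' := repr _; rewrite invgK.
have := NV _ (normal_conj x^-1 (coset_repr x)).
by rewrite -/x' /conjg mulgK invgK invgM invgK.
Qed.

Fact quotient_mulA : associative quotient_mul.
Proof.
elim/quotW=> x; elim/quotW=> y; elim/quotW=> z.
by rewrite (quotient_mulE y z) (quotient_mulE x y) !quotient_mulE mulgA.
Qed.

Fact quotient_mul1 : left_id quotient_one quotient_mul.
Proof. by elim/quotW=> x; rewrite quotient_mulE mul1g. Qed.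

Fact quotient_mulr1 : right_id quotient_one quotient_mul.
Proof. by elim/quotW=> x; rewrite quotient_mulE mulg1. Qed.

Fact quotient_mulV : left_inverse quotient_one quotient_inv quotient_mul.
Proof.
elim/quotW=> x; rewrite quotient_invE quotient_mulE.
by rewrite mulVg.
Qed.

Fact quotient_mulrV : right_inverse quotient_one quotient_inv quotient_mul.
Proof.
elim/quotW=> x; rewrite quotient_invE quotient_mulE.
by rewrite mulgV.
Qed.

HB.instance Definition _ := isGroup.Build quotient_group
  quotient_mulA quotient_mul1 quotient_mulr1 quotient_mulV quotient_mulrV.

End QuotientGroup.

Section Center.
Variable G : groupType.

Definition center_set : set G := [set z | forall x, commute z x].

Fact center_subgroup : subgroup center_set.
Proof.
split=> [x|x y xZ yZ z|x xZ z]; first exact/commute_sym/commute1.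
  by apply/commute_sym/commuteM; apply/commute_sym.
exact/commute_sym/commuteV/commute_sym.
Qed.

Fact center_conj x y : center_set x -> center_set (x ^ y).
Proof. by move=> xZ; rewrite /conjg xZ mulKg. Qed.

Definition center : normal_subgroup G :=
  NormalSubgroup center_subgroup center_conj.

End Center.

Section LowerCentralSeries.
Variable G : groupType.

(* Indexed from 1, as for 'L_n(G): G_1 = G and G_(n.+1) = [G_n, G]; the value
   at n = 0 is again G. *)
Definition lower_central_set (n : nat) : set G :=
  iter n.-1 (fun A => commutator_subgroup A [set: G]) [set: G].

Fact generated_subgroup (A : set G) : subgroup (generated A).
Proof.
split=> [M [[]//]|x y xA yA M AM|x xA M AM].
  have [[_ MM _] _] := AM.
  exact: MM (xA _ AM) (yA _ AM).
have [[_ _ MV] _] := AM.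
exact: MV (xA _ AM).
Qed.

Fact generated_conj (A : set G) : (forall x y, A x -> A (x ^ y)) ->
  forall x y, generated A x -> generated A (x ^ y).
Proof.
move=> Aconj x y xA M [[M1 MM MV] AM].
apply: (xA [set z | M (z ^ y)]); split; last first.
  by move=> z Az; apply/AM/Aconj.
split=> [|u v|u] /=; first by rewrite conj1g.
  by rewrite conjMg; apply: MM.
by rewrite conjVg; apply: MV.
Qed.

Fact lower_central_subgroup n : subgroup (lower_central_set n).
Proof.
case: n => [|[|n]]; try by split.
exact: generated_subgroup.
Qed.

Fact lower_central_conj n x y :
  lower_central_set n x -> lower_central_set n (x ^ y).
Proof.
rewrite /lower_central_set; move: n.-1 x y => {}n.
elim: n => [//|n IHn] /=; apply: generated_conj => _ y [a /= an [b _ <-]].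
by exists (a ^ y); [apply: IHn | exists (b ^ y); rewrite ?conjRg].
Qed.

Definition lower_central (n : nat) : normal_subgroup G :=
  NormalSubgroup (lower_central_subgroup n) (@lower_central_conj n).

End LowerCentralSeries.

Section FreeProduct.
Variables (I : choiceType) (A : I -> groupType).

Definition word : Type := seq {i : I & A i}.
HB.instance Definition _ := Choice.on word.

(* The congruence of the concatenation monoid of words in the disjoint union
   of the A i generated by (i, 1) ~ [::] and (i, a)(i, b) ~ (i, a * b). *)
Inductive word_cong : word -> word -> Prop :=
| word_cong_refl u : word_cong u u
| word_cong_sym u v : word_cong u v -> word_cong v u
| word_cong_trans u v w : word_cong u v -> word_cong v w -> word_cong u w
| word_cong_one u v i :
    word_cong (u ++ Tagged A (1 : A i) :: v) (u ++ v)
| word_cong_mul u v i (a b : A i) :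
    word_cong (u ++ [:: Tagged A a, Tagged A b & v])
              (u ++ Tagged A (a * b) :: v).

Definition word_rel (u v : word) : bool := `[< word_cong u v >].

Fact word_rel_refl : reflexive word_rel.
Proof. by move=> u; apply/asboolP/word_cong_refl. Qed.

Fact word_rel_sym : symmetric word_rel.
Proof. by move=> u v; apply/asboolP/asboolP; apply: word_cong_sym. Qed.

Fact word_rel_trans : transitive word_rel.
Proof.
move=> v u w /asboolP uv /asboolP vw; apply/asboolP.
exact: word_cong_trans uv vw.
Qed.

Canonical word_equiv :=
  EquivRel word_rel word_rel_refl word_rel_sym word_rel_trans.

Definition free_product : Type := {eq_quot word_equiv}.
HB.instance Definition _ := Choice.on free_product.
HB.instance Definition _ := EqQuotient.on free_product.

Definition word_inv (u : word) : word :=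
  rev [seq let: existT i a := s in Tagged A a^-1 | s <- u].

Definition free_product_mul (p q : free_product) : free_product :=
  \pi_free_product (repr p ++ repr q).
Definition free_product_inv (p : free_product) : free_product :=
  \pi_free_product (word_inv (repr p)).
Definition free_product_one : free_product := \pi_free_product ([::] : word).

Fact word_cong_cat (u u' v v' : word) :
  word_cong u u' -> word_cong v v' -> word_cong (u ++ v) (u' ++ v').
Proof.
move=> uu' vv'; apply: (@word_cong_trans _ (u' ++ v)).
  elim: uu' v {vv'} => {u u'} [u|u u' _ IH|u1 u2 u3 _ IH1 _ IH2|u v i|u v i a b] w.
  - exact: word_cong_refl.
  - exact: word_cong_sym.
  - exact: word_cong_trans (IH1 w) (IH2 w).
  - by rewrite -!catA; apply: word_cong_one.
  - by rewrite -!catA; apply: word_cong_mul.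
elim: vv' u' {u uu'} => {v v'} [v|v v' _ IH|v1 v2 v3 _ IH1 _ IH2|u v i|u v i a b] w.
- exact: word_cong_refl.
- exact: word_cong_sym.
- exact: word_cong_trans (IH1 w) (IH2 w).
- by rewrite !catA; apply: word_cong_one.
- by rewrite !catA; apply: word_cong_mul.
Qed.

Fact word_cong_inv (u v : word) :
  word_cong u v -> word_cong (word_inv u) (word_inv v).
Proof.
elim=> {u v} [u|u v _ IH|u v w _ IH1 _ IH2|u v i|u v i a b].
- exact: word_cong_refl.
- exact: word_cong_sym.
- exact: word_cong_trans IH1 IH2.
- rewrite /word_inv !map_cat /= !rev_cat rev_cons cat_rcons invg1.
  exact: word_cong_one.
- rewrite /word_inv !map_cat /= !rev_cat !rev_cons !cat_rcons invgM.
  exact: word_cong_mul.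
Qed.

Fact word_cong_mulV (u : word) : word_cong (u ++ word_inv u) [::].
Proof.
elim: u => [|[i a] u IH]; first exact: word_cong_refl.
rewrite /word_inv /= rev_cons -cats1 -/(word_inv u) catA -cat1s.
apply: (@word_cong_trans _ ([:: Tagged A a] ++ [:: Tagged A a^-1])).
  apply: (word_cong_cat (word_cong_refl _)).
  exact: (word_cong_cat IH (word_cong_refl _)).
apply: word_cong_trans (word_cong_mul [::] [::] a a^-1) _.
by rewrite mulgV; apply: (word_cong_one [::] [::]).
Qed.

Fact word_invK (u : word) : word_inv (word_inv u) = u.
Proof.
rewrite /word_inv map_rev revK -map_comp -[RHS]map_id; apply: eq_map.
by case=> i a /=; rewrite invgK.
Qed.

Fact word_cong_mulVl (u : word) : word_cong (word_inv u ++ u) [::].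
Proof. by rewrite -{2}[u]word_invK; apply: word_cong_mulV. Qed.

Fact word_cong_repr (u : word) : word_cong (repr (\pi_free_product u)) u.
Proof. by apply/asboolP/(@eqmodP _ word_equiv); rewrite reprK. Qed.

Fact free_product_mulE (u v : word) :
  free_product_mul (\pi_free_product u) (\pi_free_product v) = \pi_free_product (u ++ v).
Proof. by apply/eqmodP/asboolP/word_cong_cat; apply: word_cong_repr. Qed.

Fact free_product_invE (u : word) :
  free_product_inv (\pi_free_product u) = \pi_free_product (word_inv u).
Proof. by apply/eqmodP/asboolP/word_cong_inv/word_cong_repr. Qed.

Fact free_product_mulA : associative free_product_mul.
Proof.
elim/quotW=> x; elim/quotW=> y; elim/quotW=> z.
by rewrite (free_product_mulE y z) (free_product_mulE x y) !free_product_mulE catA.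
Qed.

Fact free_product_mul1 : left_id free_product_one free_product_mul.
Proof. by elim/quotW=> x; rewrite free_product_mulE cat0s. Qed.

Fact free_product_mulr1 : right_id free_product_one free_product_mul.
Proof. by elim/quotW=> x; rewrite free_product_mulE cats0. Qed.

Fact free_product_mulV : left_inverse free_product_one free_product_inv free_product_mul.
Proof.
elim/quotW=> x; rewrite free_product_invE free_product_mulE.
exact/eqmodP/asboolP/word_cong_mulVl.
Qed.

Fact free_product_mulrV : right_inverse free_product_one free_product_inv free_product_mul.
Proof.
elim/quotW=> x; rewrite free_product_invE free_product_mulE.
exact/eqmodP/asboolP/word_cong_mulV.
Qed.

HB.instance Definition _ := isGroup.Build free_product
  free_product_mulA free_product_mul1 free_product_mulr1
  free_product_mulV free_product_mulrV.

End FreeProduct.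

(* The name "2-nilpotent product" is justified when each A i is nilpotent of
   class at most 2, so that A i embeds; cyclic groups always qualify. *)
Definition nilpotent_product2 (I : choiceType) (A : I -> groupType) :
    groupType :=
  quotient_group (lower_central (free_product A) 3).

Definition isomorphic (G K : groupType) : Prop :=
  exists f : {multiplicative G -> K}, bijective f.

Definition capable (G : groupType) : Prop :=
  exists H : groupType, isomorphic G (quotient_group (center H)).

(* Main.v *)
From Pilot Require Import Defs.
From HB Require Import structures.
From mathcomp Require Import all_boot all_fingroup.
From mathcomp Require Import cyclic ssralg finalg zmodp ring.
From mathcomp Require Import boolp classical_sets.
(* fingroup has its own [quotient_group] and [repr]. *)
Import Pilot.Defs.
Set Implicit Arguments.
Unset Strict Implicit.
Unset Printing Implicit Defensive.

(* Necessity: if G = H / Z(H), lift the generator x_i to y_i in H, a group of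
   class at most 3, and put M = 2^alpha_(r-1).  For i < r the power y_i^M is
   central; with c = [y_i, y_r], expanding [y_i^M, y_r] = 1 shows that
   [c, y_i] and [c, y_r] have order dividing M and c has order dividing 2M,
   hence [y_i, y_r^(2M)] = 1.  So y_r^(2M) is central and x_r^(2M) = 1.

   Sufficiency: let T be a finite group of class at most 3, and call an assignment
   t of elements of T to the generators admissible when every
   t_i^(2^alpha_i) commutes with every t_j.  The generators, read as functions
   of the admissible t, generate a group H of functions with values in T, and
   x_i |-> y_i defines a surjection G -> H / Z(H).  Since every element of G is
   a word prod x_i^(a_i) prod_(i < j) [x_i, x_j]^(b_ij), the map is injective
   as soon as admissible assignments detect each a_i mod 2^alpha_i and each
   b_ij mod 2^alpha_i.  With T = {translations of n} acting on {quadratic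
   polynomials in n} over Z / 2^(alpha_r + 1), this is done by one assignment
   per pair i < j and, if alpha_r = alpha_(r-1) + 1, one more for a_r. *)

Local Open Scope group_scope.
Local Open Scope classical_set_scope.
Local Open Scope quotient_scope.

(** * Homomorphisms and quotient groups *)

Local Notation group_hom G K := (UMagmaMorphism.type G K).

Lemma group_hom_of_morph (G K : groupType) (f : G -> K) :
  {morph f : x y / x * y} -> exists g : group_hom G K, g =1 f.
Proof.
move=> fM; have f1 : f 1 = 1 by apply: (mulgI (f 1)); rewrite -fM !mulg1.
pose m := isUMagmaMorphism.Build G K f (conj f1 fM).
by exists (HB.pack_for (group_hom G K) f m).
Qed.

Section Quotient.
Variables (G : groupType) (N : normal_subgroup G).

Definition quotient_pi (g : G) : quotient_group N := \pi_(quotient_group N) g.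

Fact quotient_pi_morphism : monoid.monoid_morphism quotient_pi.
Proof. by split=> // g h; apply/esym/quotient_mulE. Qed.

HB.instance Definition _ :=
  isUMagmaMorphism.Build G (quotient_group N) quotient_pi
    quotient_pi_morphism.

Lemma quotient_pi_surj u : exists g, quotient_pi g = u.
Proof. by exists (generic_quotient.repr u); apply: reprK. Qed.

Lemma quotient_pi_eq1 g : quotient_pi g = 1 <-> normal_set N g.
Proof.
change (quotient_pi g = quotient_pi 1 <-> normal_set N g);
  split=> [/eqmodP/asboolP|Ng].
  by rewrite mulg1; have [_ _ NV] := normal_subgroupP N => /NV; rewrite invgK.
by apply/eqmodP/asboolP; rewrite mulg1; have [_ _ NV] := normal_subgroupP N;
  apply: NV.
Qed.

Lemma quotient_lift (K : groupType) (f : group_hom G K) :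
    (forall g, normal_set N g -> f g = 1) ->
  exists h : group_hom (quotient_group N) K, forall g, h (quotient_pi g) = f g.
Proof.
move=> fN; pose h (u : quotient_group N) := f (generic_quotient.repr u).
have hE g : h (quotient_pi g) = f g.
  by apply/(mulgI (h (quotient_pi g))^-1);
    rewrite mulVg -gmulfV -gmulfM fN //; apply: coset_repr.
have [|k kE] := @group_hom_of_morph _ _ h.
  move=> u v; have [g <-] := quotient_pi_surj u;
    have [g' <-] := quotient_pi_surj v.
  by rewrite -gmulfM !hE gmulfM.
by exists k => g; rewrite kE hE.
Qed.

End Quotient.

(** * Universal property of the free product *)

Section FreeProductTheory.
Variables (I : choiceType) (A : I -> groupType).

Definition free_product_incl i (a : A i) : free_product A :=
  \pi_(free_product A) [:: Tagged A a].

Fact free_product_incl_morphism i :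
  monoid.monoid_morphism (@free_product_incl i).
Proof.
split=> [|a b].
  exact/eqmodP/asboolP/(word_cong_one [::] [::]).
rewrite [RHS]free_product_mulE; apply/eqmodP/asboolP/word_cong_sym.
exact: (word_cong_mul [::] [::]).
Qed.

HB.instance Definition _ i :=
  isUMagmaMorphism.Build (A i) (free_product A) (@free_product_incl i)
    (@free_product_incl_morphism i).

Lemma free_product_ind (P : free_product A -> Prop) :
    P 1 -> (forall i (a : A i) u, P u -> P (free_product_incl a * u)) ->
  forall u, P u.
Proof.
move=> P1 PM; elim/quotW; elim=> [|[i a] w IHw]; first exact: P1.
suff -> : \pi_(free_product A) (Tagged A a :: w) = free_product_incl a * \pi w
  by apply: PM.
by rewrite [RHS]free_product_mulE.
Qed.

Lemma free_product_lift (K : groupType) (f : forall i, group_hom (A i) K) :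
  exists h : group_hom (free_product A) K,
    forall i (a : A i), h (free_product_incl a) = f i a.
Proof.
pose ev (w : word A) : K := \prod_(s <- w) f (tag s) (tagged s).
have ev_cong u v : word_cong u v -> ev u = ev v.
  elim=> {u v} // [u v w _ -> _ -> //|u v i|u v i a b];
    rewrite /ev !big_cat !big_cons /=.
    by rewrite gmulf1 mul1g.
  by rewrite gmulfM -mulgA.
pose h (p : free_product A) := ev (generic_quotient.repr p).
have hE w : h (\pi_(free_product A) w) = ev w by apply/ev_cong/word_cong_repr.
have [|k kE] := @group_hom_of_morph _ _ h.
  elim/quotW => u; elim/quotW => v.
  by rewrite [X in h X]free_product_mulE !hE /ev big_cat.
by exists k => i a; rewrite kE hE /ev big_seq1.
Qed.

End FreeProductTheory.

(** * Class at most 2 and the universal property of the 2-nilpotent product *)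

Definition class_le2 (G : groupType) := forall a b c : G, [~ [~ a, b], c] = 1.

Section NilpotentProductTheory.
Variables (I : choiceType) (A : I -> groupType).
Let G := nilpotent_product2 A.

Definition nilp_incl i : A i -> G :=
  quotient_pi (lower_central (free_product A) 3) \o @free_product_incl I A i.

HB.instance Definition _ i :=
  UMagmaMorphism.on (@nilp_incl i).

Lemma nilp_ind (P : G -> Prop) :
    P 1 -> (forall i (a : A i) u, P u -> P (nilp_incl a * u)) -> forall u, P u.
Proof.
move=> P1 PM u; have [g <-] := quotient_pi_surj u.
elim/free_product_ind: g => [|i a g IHg]; first by rewrite gmulf1.
by rewrite gmulfM; apply: PM.
Qed.

Lemma nilp_class_le2 : class_le2 G.
Proof.
move=> a b c; have [a' <-] := quotient_pi_surj a;
  have [b' <-] := quotient_pi_surj b.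
have [c' <-] := quotient_pi_surj c.
rewrite -!gmulfR; apply/quotient_pi_eq1 => M [_]; apply.
by exists [~ a', b'] => //; [move=> M' [_]; apply; exists a' => //;
  exists b' | exists c'].
Qed.

(** A homomorphism from the free product to [K] sends the second lower central term into the center
    of [K], hence kills the third and factors through the quotient. *)
Lemma nilp_lift (K : groupType) (f : forall i, group_hom (A i) K) :
    class_le2 K ->
  exists h : group_hom G K, forall i (a : A i), h (nilp_incl a) = f i a.
Proof.
move=> K2; have [k kE] := free_product_lift f.
have ker_subgroup : forall L : set K, subgroup L -> subgroup [set u | L (k u)].
  move=> L [L1 LM LV]; split=> [|u v|u] /=;
    rewrite ?gmulf1 ?gmulfM ?gmulfV //; first exact: LM.
  exact: LV.
have [|h hE] := @quotient_lift _ (lower_central (free_product A) 3) K k.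
  move=> g Ng; apply: (Ng [set u | k u = 1]); split.
    by apply: (ker_subgroup [set 1]); split=> [|x y -> ->|x ->];
      rewrite /= ?mulg1 ?invg1.
  move=> _ [a Na] [b _ <-] /=; rewrite gmulfR; apply/eqP/commgP.
  apply: (Na [set u | center_set (k u)]); split;
    first exact: (ker_subgroup _ (center_subgroup K)).
  by move=> _ [a' _ [b' _ <-]] c /=; rewrite gmulfR; apply/commgP/eqP/K2.
by exists h => i a; rewrite hE kE.
Qed.

End NilpotentProductTheory.

(** Words without inverse letters suffice when the generators have finite order, and they make a
    shorter induction. *)
Definition generating (I : Type) (G : groupType) (X : I -> G) :=
  forall P : G -> Prop, P 1 -> (forall i u, P u -> P (X i * u)) ->
    forall u, P u.

(** * Conjugates of powers in class 3 *)

Section ClassThreePowers.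
Variables (G : groupType) (a b : G).
Let c := [~ a, b].
Hypotheses (caZ : center_set [~ c, a]) (cbZ : center_set [~ c, b]).

(** Conjugating by [b] turns [c] into [c * [~ c, b]], so step n adds n copies of the central
    [[~ c, b]], and 0 + 1 + ... + (n - 1) = ['C(n, 2)]. *)
Lemma conjgX_class3 n :
  a ^ (b ^+ n) = a * c ^+ n * [~ c, b] ^+ 'C(n, 2).
Proof.
elim: n => [|n IHn]; first by rewrite !expg0 !mulg1 conjg1.
have cE : c ^ b = c * [~ c, b] by rewrite commgEl mulVKg.
have cc : commute c [~ c, b] by apply/commute_sym/cbZ.
rewrite expgSr conjgM IHn !conjMg !conjXg cE expgMn //.
rewrite -{1}[a ^ b](mulVKg a) -[a^-1 * _]commgEl -/c.
have -> : [~ c, b] ^ b = [~ c, b] by rewrite /conjg cbZ mulKg.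
by rewrite binS bin1 addnC expgnDr expgS !mulgA.
Qed.

(** The left side is [(a * c) ^+ n]; moving the last [a] past [c ^+ n] costs [[~ c, a] ^+ n]. *)
Lemma conjXg_class3 n :
  (a ^+ n) ^ b = a ^+ n * c ^+ n * [~ c, a] ^+ 'C(n, 2).
Proof.
have ab : a ^ b = a * c by rewrite /c commgEl mulVKg.
clearbody c; clear cbZ.
elim: n => [|n IHn]; first by rewrite !expg0 !mulg1 conj1g.
have ca : c ^+ n * a = a * c ^+ n * [~ c, a] ^+ n.
  rewrite -mulgA -expgMn; last exact/commute_sym/caZ.
  by rewrite commgEl mulVKg -conjXg -conjgC.
have dZ k : center_set ([~ c, a] ^+ k) by move=> g;
  apply/commute_sym/commuteX/commute_sym.
rewrite expgSr conjMg IHn ab.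
rewrite -[LHS]mulgA (dZ _) -!mulgA [c ^+ n * (a * _)]mulgA ca.
rewrite binS bin1 addnC expgnDr expgSr -!mulgA (mulgA (_ ^+ n) c) (dZ n c)
  !mulgA.
by rewrite -!expgSr.
Qed.

(* d = [c, a] and e = [c, b] satisfy d^M = [c^M, a] and e^M = [c^M, b], and
   c^M = d^-C(M, 2) is central; hence d^M = e^M = 1 and c^(2M) = 1. *)
Lemma commute_expg_double M :
  center_set (a ^+ M) -> commute a (b ^+ (2 * M)).
Proof.
move=> aMZ.
have rel : c ^+ M * [~ c, a] ^+ 'C(M, 2) = 1.
  apply: (mulgI (a ^+ M)); rewrite mulg1 mulgA -conjXg_class3.
  by rewrite /conjg aMZ mulKg.
have expZ z k : center_set z -> center_set (z ^+ k).
  by move=> zZ g; apply/commute_sym/commuteX/commute_sym.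
have cMZ : center_set (c ^+ M).
  move/(canRL (mulgK _)): rel; rewrite mul1g => ->.
  by have [_ _] := center_subgroup G; apply; apply: expZ.
(* Conjugation by [g] fixes the central [c ^+ M], yet multiplies it by [[~ c, g] ^+ M]. *)
have power g : center_set [~ c, g] -> [~ c, g] ^+ M = 1.
  move=> cgZ; have cE : c ^ g = c * [~ c, g] by rewrite commgEl mulVKg.
  apply: (mulgI (c ^+ M)); rewrite mulg1 -expgMn; last exact/commute_sym/cgZ.
  by rewrite -cE -conjXg /conjg cMZ mulKg.
have c2M : c ^+ (2 * M) = 1.
  rewrite mulnC expgnA; have -> : c ^+ M = [~ c, a] ^- 'C(M, 2).
    by apply/esym/divg1_eq; rewrite -invgM rel invg1.
  rewrite -expVgn -expgnA muln2 -addnn; have [->|M0] := posnP M;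
    first by rewrite expg0.
  have -> : ('C(M, 2) + 'C(M, 2) = M * M.-1)%N.
    by case: (M) M0 => // m _; rewrite addnn bin2 /= halfK oddM /= andNb subn0.
  by rewrite expgnA expVgn power // invg1 expg1n.
(* ['C(2 * M, 2)] is M(2M - 1), a multiple of M. *)
have e2M : [~ c, b] ^+ 'C(2 * M, 2) = 1.
  by rewrite bin2 mul2n -doubleMl doubleK expgnA power // expg1n.
by rewrite /commute conjgC conjgX_class3 c2M e2M !mulg1.
Qed.

End ClassThreePowers.

(** * Cyclic factors and the necessity of the bound *)

Lemma cyclic_lift (D : finGroupType) (d : D) (K : groupType) (k : K) :
    [set: D]%SET = <[d]> -> k ^+ #[d] = 1 ->
  exists f : group_hom D K, f d = k.
Proof.
move=> Dd kd.
have ex a : exists n, d ^+ n == a.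
  have /cycleP[n ->] : a \in <[d]> by rewrite -Dd inE.
  by exists n.
pose f a := k ^+ ex_minn (ex a).
have fE n : f (d ^+ n) = k ^+ n.
  rewrite /f; case: ex_minnP => m /eqP/eqP.
  rewrite eq_expg_mod_order => /eqP mn _.
  have modk j : k ^+ j = k ^+ (j %% #[d]).
    by rewrite {1}(divn_eq j #[d]) expgnDr mulnC expgnA kd expg1n mul1g.
  by rewrite modk mn -modk.
have [|h hE] := @group_hom_of_morph _ _ f; last by exists h;
  rewrite hE -[d]expg1 fE.
move=> a b; have /cycleP[m ->] : a \in <[d]> by rewrite -Dd inE.
have /cycleP[n ->] : b \in <[d]> by rewrite -Dd inE.
by rewrite -expgnDr !fE expgnDr.
Qed.

Section CyclicFactors.
Variables (r : nat) (C : 'I_r -> finGroupType).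
Variables (x : forall i, C i) (alpha : 'I_r -> nat).
Hypothesis (hgen : forall i, [set: C i]%SET = <[x i]>).
Let G := nilpotent_product2 C.

Definition nilp_gen i : G := nilp_incl (x i).

Lemma nilp_gen_generating : generating nilp_gen.
Proof.
move=> P P1 PM; apply: nilp_ind => // i a u Pu.
have /cycleP[n ->] : a \in <[x i]> by rewrite -hgen inE.
elim: n => [|n IHn]; first by rewrite expg0 gmulf1 mul1g.
by rewrite expgS gmulfM -mulgA; apply: PM.
Qed.

Lemma nilp_gen_lift (K : groupType) (k : 'I_r -> K) :
    class_le2 K -> (forall i, k i ^+ #[x i] = 1) ->
  exists h : group_hom G K, forall i, h (nilp_gen i) = k i.
Proof.
move=> K2 kx.
have ex i := @cyclic_lift (C i) (x i) K (k i) (hgen i) (kx i).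
have [h hE] := nilp_lift (fun i => projT1 (cid (ex i))) K2.
by exists h => i; rewrite hE; case: cid.
Qed.

(** The retraction of [G] onto [C i] that kills the other generators sends [nilp_gen i] to [x i], so
    the order cannot drop. *)
Lemma nilp_gen_order i n : nilp_gen i ^+ n = 1 -> (#[x i] %| n)%N.
Proof.
move=> xn; have C2 : class_le2 (C i).
  suff ab (a b : C i) : commute a b by move=> a b c; apply/eqP/commgP/ab.
  have /cycleP[m ->] : a \in <[x i]> by rewrite -hgen inE.
  have /cycleP[m' ->] : b \in <[x i]> by rewrite -hgen inE.
  exact: commuteX2.
pose k j : C i := if j =P i is ReflectT e then ecast l (C l) e (x j) else 1.
have kx j : k j ^+ #[x j] = 1.
  rewrite /k; case: eqP => [e|_]; last exact: expg1n.
  by destruct e; apply: expg_order.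
have [h hE] := nilp_gen_lift C2 kx.
have ki : k i = x i by rewrite /k; case: eqP => // e; rewrite eq_axiomK.
by rewrite order_dvdn -ki -hE -gmulfXn xn gmulf1.
Qed.

(** Turns capability into conditions on lifts [y i] of the generators: a power of [y i] is central
    exactly when that power of [nilp_gen i] is trivial, and centrality need only be tested against
    the lifts. *)
Lemma capable_gens : capable G ->
  exists (H : groupType) (y : 'I_r -> H),
    [/\ forall a b c : H, center_set [~ [~ a, b], c],
        forall i n, nilp_gen i ^+ n = 1 -> center_set (y i ^+ n)
      & forall i n, (forall j, commute (y j) (y i ^+ n)) ->
          nilp_gen i ^+ n = 1].
Proof.
case=> H [f' f'_bij]; have [f fE] := group_hom_of_morph (gmulfM (s := f')).
have [g fK gK] : bijective f by apply: (eq_bij f'_bij) => u; rewrite fE.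
pose pi : group_hom H (quotient_group (center H)) := quotient_pi (center H).
have piZ h : center_set h <-> pi h = 1.
  by split=> [hZ|/quotient_pi_eq1 //]; apply/(quotient_pi_eq1 (center H)).
have [y yE] : exists y : 'I_r -> H, forall i, pi (y i) = f (nilp_gen i).
  have ex i : exists h, pi h = f (nilp_gen i) by apply: quotient_pi_surj.
  by exists (fun i => projT1 (cid (ex i))) => i; case: cid.
exists H, y; split=> [a b c|i n xn|i n yC].
- apply/piZ; rewrite !gmulfR -(gK (pi a)) -(gK (pi b)) -(gK (pi c)).
  by rewrite -!gmulfR nilp_class_le2 gmulf1.
- by apply/piZ; rewrite gmulfXn yE -gmulfXn xn gmulf1.
apply: (can_inj fK); rewrite gmulf1 gmulfXn -yE -gmulfXn; apply/piZ => h.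
(* The [y j] generate [H] only modulo its center, so the induction runs over [G] and quantifies over
   all lifts to [H]. *)
apply/commute_sym; pose P u := forall h, pi h = f u -> commute h (y i ^+ n).
suff: P (g (pi h)) by apply; rewrite gK.
elim/nilp_gen_generating: (g (pi h)) => [k|j u IHu k];
  first by rewrite gmulf1 => /piZ.
rewrite gmulfM -yE => kE; rewrite -[k](mulVKg (y j)).
apply/commute_sym/commuteM; first exact/commute_sym/yC.
by apply/commute_sym/IHu; rewrite gmulfM gmulfV kE mulKg.
Qed.

Hypothesis (hord : forall i, #[x i] = (2 ^ alpha i)%N).
Hypothesis (halpha1 : forall i, 1 <= alpha i).
Hypothesis (halpha : forall i j : 'I_r, i <= j -> alpha i <= alpha j).

Lemma nilp_gen_exp i n : alpha i <= n -> nilp_gen i ^+ (2 ^ n) = 1.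
Proof.
move=> le_n; rewrite /nilp_gen -gmulfXn; apply/eqP.
suff -> : x i ^+ (2 ^ n) = 1 by rewrite gmulf1.
by apply/eqP; rewrite -order_dvdn hord dvdn_exp2l.
Qed.

Lemma capable_bound (hr : 0 < r) : capable G ->
  1 < r /\ forall i j : 'I_r, i.+2 = r -> j.+1 = r -> alpha j <= alpha i + 1.
Proof.
move=> /capable_gens[H [y [Z3 yZ yC]]]; split=> [|i l ir lr].
  rewrite ltnNge; apply/negP => r1; pose i := Ordinal hr.
  have i_only j : j = i by apply: val_inj; case: j => [[|j]] //=;
    move/(fun h => leq_trans h r1).
  have: nilp_gen i ^+ 1 = 1 by apply: yC => j; rewrite (i_only j) expg1.
  by move=> /nilp_gen_order; rewrite hord dvdn1 -(expn0 2) eqn_exp2l // -leqn0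
    leqNgt halpha1.
suff: nilp_gen l ^+ (2 ^ (alpha i + 1)) = 1.
  by move=> /nilp_gen_order; rewrite hord dvdn_Pexp2l.
apply: yC => j; have [->|jl] := eqVneq j l; first exact/commuteX.
(* Here M is [2 ^ alpha i]: every [j] other than [l] is at most [i], so the M-th power of [y j] is
   central. *)
rewrite addn1 expnS; apply: commute_expg_double; rewrite ?Z3 //.
apply/yZ/nilp_gen_exp/halpha; have : j < i.+2 by rewrite ir.
rewrite ltnS leq_eqVlt => /orP[/eqP ji|//]; case/eqP: jl;
  apply/val_inj/eqP => /=.
by rewrite ji -eqSS ir lr.
Qed.

End CyclicFactors.

(** * Translations acting on quadratic polynomials *)

(* (i, p, q, c) stands for the polynomial p n^2 + q n + c followed by the
   translation n -> n + i, so that the product of (f, i) and (g, j) is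
   (f(n + j) + g(n), i + j). *)
Definition poly_shift (R : Type) : Type := (R * R * R * R)%type.

Section PolyShift.
Import GRing.Theory.
Variable R : finComNzRingType.
Local Notation T := (poly_shift R).
HB.instance Definition _ := Finite.copy T (R * R * R * R)%type.
Local Open Scope ring_scope.

Definition shift_coord (u : T) : R := u.1.1.1.
Definition quad_coord (u : T) : R := u.1.1.2.
Definition lin_coord (u : T) : R := u.1.2.

Definition poly_shift_mul (u v : T) : T :=
  let: (i, p, q, c) := u in let: (j, p', q', c') := v in
  (i + j, p + p', q + q' + 2 * p * j, c + c' + q * j + p * j ^+ 2).
Definition poly_shift_inv (u : T) : T :=
  let: (i, p, q, c) := u in (- i, - p, 2 * p * i - q, q * i - p * i ^+ 2 - c).

Fact poly_shift_mulA : associative poly_shift_mul.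
Proof.
move=> [[[i p] q] c] [[[j p'] q'] c'] [[[k p''] q''] c''] /=.
by congr (_, _, _, _); ring.
Qed.
Fact poly_shift_mul1 : left_id (0, 0, 0, 0) poly_shift_mul.
Proof. by move=> [[[i p] q] c] /=; congr (_, _, _, _); ring. Qed.
Fact poly_shift_mulV : left_inverse (0, 0, 0, 0) poly_shift_inv poly_shift_mul.
Proof. by move=> [[[i p] q] c] /=; congr (_, _, _, _); ring. Qed.

HB.instance Definition _ := Finite_isGroup.Build T
  poly_shift_mulA poly_shift_mul1 poly_shift_mulV.

Lemma poly_shift_commute i p q c j p' q' c' :
  @commute T (i, p, q, c) (j, p', q', c') <->
  2 * p * j = 2 * p' * i /\ q * j + p * j ^+ 2 = q' * i + p' * i ^+ 2.
Proof.
split=> [[_ _ e1 e2]|[e1 e2]]; last first.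
  congr (_, _, _, _); first exact: addrC; first exact: addrC.
    by rewrite e1 (addrC q).
  by rewrite -!addrA e2 !addrA (addrC c).
split; first by apply: (addrI (q + q')); rewrite e1 (addrC q).
by apply: (addrI (c + c')); rewrite !addrA e2 (addrC c).
Qed.

Lemma shift_coordM : {morph shift_coord : u v / (u * v)%g >-> u + v}.
Proof. by move=> [[[i p] q] c] [[[j p'] q'] c']. Qed.

Lemma quad_coordM : {morph quad_coord : u v / (u * v)%g >-> u + v}.
Proof. by move=> [[[i p] q] c] [[[j p'] q'] c']. Qed.

Lemma poly_shift_commg i p q c j p' q' c' :
  [~ (i, p, q, c) : T, (j, p', q', c')]%g =
    (0, 0, 2 * p * j - 2 * p' * i,
      q * j + p * j ^+ 2 - q' * i - p' * i ^+ 2).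
Proof. by congr (_, _, _, _); ring. Qed.

(** A commutator is a polynomial of degree at most 1 without translation, a further one is a
    constant, and constants are central. *)
Lemma poly_shift_class3 (a b c d : T) : [~ [~ [~ a, b], c], d]%g = 1%g.
Proof.
case: a b c d => [[[i p] q] k] [[[i' p'] q'] k'] [[[j p''] q''] k'']
  [[[m u] v] w].
by rewrite !poly_shift_commg; congr (_, _, _, _); ring.
Qed.

Definition shift_elt (a : R) : T := (1, a, 0, 0).
(** The polynomial a n(n - 1); translation by k changes it by 2akn + ak(k - 1). *)
Definition poly_elt (a : R) : T := (0, a, - a, 0).

Lemma shift_eltX a n : exists c,
  (shift_elt a ^+ n)%g = (n%:R, n%:R * a, n%:R * (n%:R - 1) * a, c).
Proof.
elim: n => [|n [c IHn]]; first by exists 0; rewrite expg0; congr (_, _, _, _);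
  ring.
by rewrite expgSr IHn; eexists; congr (_, _, _, _); ring.
Qed.

Lemma poly_eltX a n : (poly_elt a ^+ n)%g = (0, n%:R * a, - (n%:R * a), 0).
Proof.
elim: n => [|n IHn]; first by rewrite expg0; congr (_, _, _, _); ring.
by rewrite expgSr IHn; congr (_, _, _, _); ring.
Qed.

End PolyShift.

(** * Normal forms in class at most 2 *)

Section NormalWords.
Variable r : nat.
Implicit Types (a : 'I_r -> nat) (b : 'I_r * 'I_r -> nat).

Definition gen_word (G : groupType) (X : 'I_r -> G) a : G := \prod_i X i ^+ a i.

Definition comm_word (G : groupType) (X : 'I_r -> G) b : G :=
  \prod_(p : 'I_r * 'I_r | p.1 < p.2) [~ X p.1, X p.2] ^+ b p.

Lemma hom_gen_word (G K : groupType) (f : group_hom G K)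
    (X : 'I_r -> G) (Y : 'I_r -> K) a :
  (forall i, f (X i) = Y i) -> f (gen_word X a) = gen_word Y a.
Proof.
by move=> fX; rewrite gmulf_prod; apply: eq_bigr => i _; rewrite gmulfXn fX.
Qed.

Lemma hom_comm_word (G K : groupType) (f : group_hom G K)
    (X : 'I_r -> G) (Y : 'I_r -> K) b :
  (forall i, f (X i) = Y i) -> f (comm_word X b) = comm_word Y b.
Proof.
by move=> fX; rewrite gmulf_prod; apply: eq_bigr => p _;
  rewrite gmulfXn gmulfR !fX.
Qed.

Lemma commXg_class2 (G : groupType) (g h : G) n : class_le2 G ->
  [~ g ^+ n, h] = [~ g, h] ^+ n.
Proof.
move=> G2; have Z k : center_set [~ [~ g, h], k] by rewrite G2;
  have [] := center_subgroup G.
by rewrite [LHS]commgEl conjXg_class3 // G2 expg1n mulg1 mulKg.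
Qed.

Lemma commgX_class2 (G : groupType) (g h : G) n : class_le2 G ->
  [~ g, h ^+ n] = [~ g, h] ^+ n.
Proof.
by move=> G2; rewrite -invgR commXg_class2 // -invgR expVgn invgK.
Qed.

Section Class2.
Variables (G : groupType) (X : 'I_r -> G) (N : 'I_r -> nat).
Hypotheses (G2 : class_le2 G) (N_gt0 : forall i, 0 < N i).
Hypothesis (XN : forall i, X i ^+ N i = 1).

Lemma commute_commg (g h k : G) : commute [~ g, h] k.
Proof. exact/commgP/eqP/G2. Qed.

Lemma comm_wordM b b' :
  comm_word X b * comm_word X b' = comm_word X (fun p => b p + b' p).
Proof.
rewrite /comm_word -prodgM_commute; first by apply: eq_bigr => p _;
  rewrite expgnDr.
by move=> p q _ _; apply: commuteX2; apply: commute_commg.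
Qed.

Lemma comm_word0 : comm_word X (fun=> 0) = 1.
Proof. by rewrite /comm_word big1. Qed.

Lemma comm_wordX b n : comm_word X b ^+ n = comm_word X (fun p => b p * n)%N.
Proof.
elim: n => [|n IHn].
  by rewrite expg0 -comm_word0; apply: eq_bigr => p _; rewrite muln0.
by rewrite expgSr IHn comm_wordM; apply: eq_bigr => p _; rewrite mulnS addnC.
Qed.

Lemma commg_comm_word i j : exists b, [~ X i, X j] = comm_word X b.
Proof.
have lt_ij (k l : 'I_r) : k < l -> exists b, [~ X k, X l] = comm_word X b.
  move=> kl; exists (fun p => p == (k, l)).
  rewrite /comm_word (eq_bigr _ (fun p _ => expgb _ _)) -big_mkcondr.
  rewrite (big_pred1 (k, l)) // => p; rewrite /= andbC.
  by case: eqP => // ->.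
case: (ltngtP i j) => [/lt_ij //|ji|/val_inj->]; last first.
  by exists (fun=> 0); rewrite commgg comm_word0.
(* Exponents are natural numbers, so the inverse of [[~ X j, X i]] is written as its power
   [(N j).-1]. *)
have [b bE] := lt_ij _ _ ji; exists (fun p => b p * (N j).-1)%N.
rewrite -comm_wordX -bE -invgR; apply: mulg1_eq.
by rewrite -expgS prednK // -commXg_class2 // XN comm1g.
Qed.

(** Moving [X i] to its place past the powers of earlier generators leaves only commutators, which
    are central and collect on the right. *)
Lemma gen_word_cons i a : exists b,
  X i * gen_word X a = gen_word X (fun j => a j + (j == i)) * comm_word X b.
Proof.
suff cons_seq (s : seq 'I_r) : uniq s -> exists b,
    (if i \in s then X i else 1) * \prod_(j <- s) X j ^+ a j =
      \prod_(j <- s) X j ^+ (a j + (j == i)) * comm_word X b.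
  have := cons_seq (index_enum 'I_r) (index_enum_uniq _).
  by rewrite mem_index_enum.
elim: s => [_|j s IHs /= /andP[js us]].
  by exists (fun=> 0); rewrite !big_nil comm_word0 !mul1g.
have [b bE] := IHs us; rewrite !big_cons in_cons.
have [eij|nij] := eqVneq i j.
  rewrite -eij in js *; exists b; rewrite orTb addn1 expgS -!mulgA -bE.
  by rewrite (negPf js) mul1g.
rewrite /= addn0; case: ifP bE => [_|_] bE; last first.
  by exists b; rewrite mul1g -mulgA -bE mul1g.
have [b' b'E] := commg_comm_word i j; exists (fun p => b p + b' p * a j)%N.
rewrite -comm_wordM -comm_wordX -b'E -commgX_class2 // mulgA -[RHS]mulgA.
rewrite (mulgA (\prod_(_ <- s) _)) -bE (commgC (X i) (X j ^+ a j)) -[LHS]mulgA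
  -[in LHS]mulgA; congr (_ * _).
by rewrite commute_commg mulgA.
Qed.

Lemma normal_form : generating X ->
  forall u, exists a b, u = gen_word X a * comm_word X b.
Proof.
move=> Xgen; apply: Xgen => [|i _ [a [b ->]]].
  exists (fun=> 0), (fun=> 0); rewrite comm_word0 mulg1.
  by rewrite /gen_word big1.
have [b' bE] := gen_word_cons i a.
exists (fun j => a j + (j == i))%N, (fun p => b' p + b p)%N.
by rewrite mulgA bE -mulgA comm_wordM.
Qed.

End Class2.
End NormalWords.

(** * Subgroups of a power of a finite group *)

HB.instance Definition _ (K : finType) (T : finGroupType) :=
  Finite.on {ffun K -> T}.

Lemma generating_central (I : Type) (G : groupType) (X : I -> G) z :
  generating X -> (forall i, commute z (X i)) -> center_set z.
Proof.
by move=> Xgen zX; apply: Xgen => [|i u]; [apply: commute1 | apply: commuteM].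
Qed.

(** [H] is generated inside the [K]-fold power of [T] by the functions sending [k] to [t k i]; the
    [ev k] are the projections, so identities in [H] are checked one assignment at a time. *)
Lemma subdirect_group (I K : finType) (T : finGroupType) (t : K -> I -> T) :
  exists (H : groupType) (y : I -> H) (ev : K -> group_hom H T),
    [/\ generating y, forall k i, ev k (y i) = t k i
      & forall h, (forall k, ev k h = 1) -> h = 1].
Proof.
pose w i : {ffun K -> T} := [ffun k => t k i].
pose S : {group {ffun K -> T}} := <<[set w i | i in I]%SET>>%G.
have wS i : w i \in S by apply/mem_gen/imset_f.
pose y i : subg_of S := subg S (w i).
have sgM (h h' : subg_of S) : sgval (h * h') = sgval h * sgval h' by [].
have sgV (h : subg_of S) : sgval h^-1 = (sgval h)^-1 by [].
have yE i : sgval (y i) = w i by rewrite subgK.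
have [ev evE] : exists ev : K -> group_hom (subg_of S) T,
    forall k h, ev k h = sgval h k.
  have ex k : exists f : group_hom (subg_of S) T, forall h, f h = sgval h k.
    by apply: group_hom_of_morph => h h'; rewrite sgM ffunE.
  by exists (fun k => projT1 (cid (ex k))) => k; case: cid.
exists (subg_of S), y, ev; split=> [P P1 PM h|k i|h h1].
- have /gen_prodgP[n [c cw hE]] := subgP h.
  elim: n c cw h hE => [|n IHn] c cw h.
    by rewrite big_ord0 => h1; have -> : h = 1 by apply: val_inj.
  rewrite big_ord_recl; have /imsetP[i _ ->] := cw ord0 => hE.
  rewrite -(mulVKg (y i) h); apply: PM.
  apply: (IHn (fun j => c (lift ord0 j))) => //.
  by rewrite sgM sgV hE yE mulKg.
- by rewrite evE yE ffunE.
by apply/val_inj/ffunP => k; rewrite -evE h1 ffunE.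
Qed.

(** * Assignments that detect exponents *)

Section Detection.
Import GRing.Theory.
Local Open Scope ring_scope.
Variables (R : finComNzRingType) (s : R) (M : nat).
Hypothesis sM : forall k, s * k%:R = 0 <-> (2 * M %| k)%N.
Hypothesis M_even : (2 %| M)%N.
Local Notation T := (poly_shift R).

(** A homomorphism to an additive group kills commutators, so only the generators contribute. *)
Lemma coord_normal_word (phi : T -> R) r (t : 'I_r -> T) a b :
    {morph phi : u v / (u * v)%g >-> u + v} ->
  phi (gen_word t a * comm_word t b)%g = \sum_i phi (t i) * (a i)%:R.
Proof.
move=> phiM; have phi1 : phi 1%g = 0 by apply: (addrI (phi 1%g));
  rewrite -phiM mulg1 addr0.
have phiX u n : phi (u ^+ n)%g = phi u * n%:R.
  by elim: n => [|n IHn]; rewrite ?expg0 ?phi1 ?mulr0 // expgS phiM IHn -natr1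
    mulrDr mulr1 addrC.
have phiR u v : phi [~ u, v]%g = 0.
  by apply: (addrI (phi (v * u)%g)); rewrite -phiM -commgC addr0 !phiM addrC.
rewrite phiM /gen_word /comm_word !(big_morph phi phiM phi1) [X in _ + X]big1
  ?addr0 => [|p _].
  by apply: eq_bigr => i _; rewrite phiX.
by rewrite phiX phiR mul0r.
Qed.

Lemma double_eq0 k : 2 * s * k%:R = 0 <-> (M %| k)%N.
Proof.
by rewrite -(@dvdn_pmul2l 2) // -sM natrM mulrCA mulrA.
Qed.

Lemma sum_pair r (i j : 'I_r) (f : 'I_r -> R) : i != j ->
  (forall l, l != i -> l != j -> f l = 0) -> \sum_l f l = f i + f j.
Proof.
move=> ij f0; rewrite (bigD1 i) //= (bigD1 j) 1?eq_sym //= big1 ?addr0 //.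
by move=> l /andP[li lj]; apply: f0.
Qed.

Section Pair.
Variables (r : nat) (i j : 'I_r) (o : 'I_r -> nat).

(* As s has additive order 2M, the images of these generators modulo the center
   have order M, and so does their commutator, a polynomial -2sn + c. *)
Definition shift_pair (l : 'I_r) : T :=
  if l == i then shift_elt 0 else if l == j then shift_elt s else 1%g.

(** Every multiple k of [M] satisfies 2sk = 0 and also sk^2 = 0, because [M] is even and so 2M
    divides k^2. *)
Lemma shift_pair_admissible l m : o i = M -> (M %| o j)%N ->
  commute (shift_pair l ^+ o l)%g (shift_pair m).
Proof.
move=> oi oj; rewrite /shift_pair; have [->|_] := eqVneq l i.
  rewrite oi; have [c ->] := shift_eltX (0 : R) M.
  have M0 : 2 * s * M%:R = 0 by apply/double_eq0.
  have MM0 : s * M%:R ^+ 2 = 0 by rewrite -natrX; apply/sM/dvdn_mul.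
  case: eqP => _; first by apply/poly_shift_commute; split; ring.
  case: eqP => _; last exact: commute1.
  apply/poly_shift_commute; rewrite M0; split; first by ring.
  by rewrite MM0; ring.
have [->|_] := eqVneq l j; last by rewrite expg1n; apply/commute_sym/commute1.
have [c ->] := shift_eltX s (o j); set k := o j in oj *.
have k0 : 2 * s * k%:R = 0 by apply/double_eq0.
have kk0 : s * k%:R ^+ 2 = 0 by rewrite -natrX; apply/sM/dvdn_mul => //;
  apply: dvdn_trans oj.
case: eqP => _.
  apply/poly_shift_commute; split; first by transitivity (2 * s * k%:R);
    [ring | rewrite k0; ring].
  by transitivity (s * k%:R ^+ 2); [ring | rewrite kk0; ring].
case: eqP => _; last exact: commute1.
apply/poly_shift_commute; split; first by ring.
by ring.
Qed.

Lemma shift_pair_central (u : T) : i != j ->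
    (forall m, commute u (shift_pair m)) ->
  [/\ 2 * quad_coord u = 0, lin_coord u + quad_coord u = 0
    & 2 * s * shift_coord u = 0].
Proof.
move=> ij uC; have := uC i; have := uC j;
  rewrite /shift_pair eqxx eq_sym (negPf ij) eqxx.
case: u {uC} => [[[I P] Q] c] /poly_shift_commute[e1 e2].
move=> /poly_shift_commute[e3 e4].
rewrite /quad_coord /lin_coord /shift_coord /=; split.
- by rewrite -[LHS]mulr1 e3; ring.
- by transitivity (Q * 1 + P * 1 ^+ 2); [ring | rewrite e4; ring].
- by rewrite -e1 e3; ring.
Qed.

(** The word has quadratic coordinate s a_j and shift coordinate a_i + a_j. By [shift_pair_central]
    twice the former and 2s times the latter vanish, so [M] divides a_j and then a_i. *)
Lemma shift_pair_detect a b : i != j ->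
    (forall m, commute (gen_word shift_pair a * comm_word shift_pair b)%g
                 (shift_pair m)) ->
  (M %| a i)%N /\ (M %| a j)%N.
Proof.
move=> ij /(shift_pair_central ij)[P0 _ I0]; move: P0 I0.
rewrite (coord_normal_word _ _ _ (@quad_coordM R)).
rewrite (coord_normal_word _ _ _ (@shift_coordM R)).
rewrite !(sum_pair ij) => [|l li lj|l li lj];
  try by rewrite /shift_pair (negPf li) (negPf lj) mul0r.
rewrite /shift_pair eqxx eq_sym (negPf ij) eqxx /shift_coord /quad_coord /=
  mul0r add0r mulrA.
rewrite !mul1r -natrD => /double_eq0 Mj /double_eq0; rewrite dvdn_addl //.
Qed.

Lemma shift_pair_detect_comm b : i < j ->
    (forall m, commute (comm_word shift_pair b) (shift_pair m)) ->
  (M %| b (i, j))%N.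
Proof.
move=> ltij; have ij : i != j by rewrite neq_ltn ltij.
have pow n : exists c,
    ([~ shift_pair i, shift_pair j] ^+ n)%g = (0, 0, - (2 * s * n%:R), c).
  rewrite /shift_pair eqxx eq_sym (negPf ij) eqxx poly_shift_commg.
  elim: n => [|n [c IHn]]; first by exists 0; rewrite expg0;
    congr (_, _, _, _); ring.
  by rewrite expgSr IHn; eexists; congr (_, _, _, _); rewrite ?natr1; ring.
have -> : comm_word shift_pair b =
    ([~ shift_pair i, shift_pair j] ^+ b (i, j))%g.
  rewrite /comm_word (eq_bigr (fun p =>
    if p == (i, j) then [~ shift_pair i, shift_pair j] ^+ b (i, j) else 1)%g).
    by rewrite -big_mkcondr (big_pred1 (i, j)) // => -[k l] /=; rewrite andbC;
      case: eqP => // -[-> ->].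
  move=> [k l] /= kl; case: eqP => [[-> ->] //|ne];
    rewrite -[RHS](expg1n _ (b (k, l))); congr natexp.
  apply/eqP/commgP; rewrite /shift_pair.
  case: (eqVneq k i) => [ki|_].
    case: (eqVneq l i) => [_|_]; first exact: commute_refl.
    by case: (eqVneq l j) => [lj|_]; [case: ne;
      rewrite ki lj | apply: commute1].
  case: (eqVneq k j) => [kj|_]; last exact/commute_sym/commute1.
  case: (eqVneq l i) => [li|_]; first by rewrite kj li ltnNge ltnW in kl.
  by case: (eqVneq l j) => _; [apply: commute_refl | apply: commute1].
have [c ->] := pow (b (i, j)).
move=> /(shift_pair_central ij)[_ + _]; rewrite /lin_coord /quad_coord /= addr0.
by move/eqP; rewrite oppr_eq0 => /eqP/double_eq0.
Qed.

End Pair.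

Section Top.
Variables (r : nat) (i j : 'I_r) (o : 'I_r -> nat).

(* The polynomial s n(n - 1) is fixed by the translation by 2M but not by the
   one by M, so the second generator has order 2M modulo the center although
   the first one only has order M. *)
Definition shift_top (l : 'I_r) : T :=
  if l == i then poly_elt s else if l == j then shift_elt 0 else 1%g.

(** Translation by 1 changes ks n(n - 1) by 2skn, zero when M divides k; translation by k changes s
    n(n - 1) by a multiple of sk, zero when 2M divides k. *)
Lemma shift_top_admissible l m : (M %| o i)%N -> (2 * M %| o j)%N ->
  commute (shift_top l ^+ o l)%g (shift_top m).
Proof.
move=> oi oj; rewrite /shift_top; have [->|_] := eqVneq l i.
  rewrite poly_eltX; set k := o i in oi *.
  have k0 : 2 * s * k%:R = 0 by apply/double_eq0.
  case: eqP => _; first by apply/poly_shift_commute; split; ring.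
  case: eqP => _; last exact: commute1.
  apply/poly_shift_commute; split; last by ring.
  by transitivity (2 * s * k%:R); [ring | rewrite k0; ring].
have [->|_] := eqVneq l j; last by rewrite expg1n; apply/commute_sym/commute1.
have [c ->] := shift_eltX (0 : R) (o j); set k := o j in oj *.
have k0 : s * k%:R = 0 by apply/sM.
case: eqP => _.
  apply/poly_shift_commute; split.
    by transitivity (2 * (s * k%:R)); [rewrite k0; ring | ring].
  by transitivity ((k%:R - 1) * (s * k%:R)); [rewrite k0; ring | ring].
case: eqP => _; last exact: commute1.
by apply/poly_shift_commute; split; ring.
Qed.

Lemma shift_top_detect a b : i != j ->
    (forall m, commute (gen_word shift_top a * comm_word shift_top b)%g
                 (shift_top m)) ->
  (2 * M %| a j)%N.
Proof.
move=> ij /(_ i); rewrite /shift_top eqxx -/shift_top.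
have := coord_normal_word shift_top a b (@shift_coordM R).
rewrite (sum_pair ij) => [|l li lj];
  last by rewrite /shift_top (negPf li) (negPf lj) mul0r.
rewrite /shift_top eqxx eq_sym (negPf ij) eqxx /shift_coord /= mul0r add0r
  mul1r.
case: (_ * _)%g => [[[I P] Q] c] /= -> /poly_shift_commute[e1 e2].
have a1 : 2 * s * (a j)%:R = 0 by rewrite -e1; ring.
have a2 : s * ((a j)%:R ^+ 2 - (a j)%:R) = 0.
  by transitivity (- s * (a j)%:R + s * (a j)%:R ^+ 2); [ring | rewrite -e2;
    ring].
have [->//|a_gt0] := posnP (a j).
have Ma : (M %| a j)%N by apply/double_eq0.
have: (2 * M %| a j * (a j).-1)%N.
  apply/sM; rewrite natrM -subn1 natrB // -a2; ring.
(* As a multiple of the even [M], [a j] is even, so its predecessor is coprime to 2M. *)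
rewrite Gauss_dvdl //.
have ca : coprime (a j) (a j).-1 by rewrite -{1}(prednK a_gt0) coprimeSn.
by rewrite coprimeMl !(coprime_dvdl _ ca) // (dvdn_trans M_even).
Qed.
End Top.
End Detection.

(** * A criterion for capability *)

Lemma capable_of_generators (r : nat) (C : 'I_r -> finGroupType)
    (x : forall i, C i) (H : groupType) (y : 'I_r -> H) :
    (forall i, [set: C i]%SET = <[x i]>) -> generating y ->
    (forall a b c d : H, [~ [~ [~ a, b], c], d] = 1) ->
    (forall i, center_set (y i ^+ #[x i])) ->
    (forall a b, center_set (gen_word y a * comm_word y b) ->
       forall i, #[x i] %| a i) ->
    (forall b, center_set (comm_word y b) ->
       forall i j : 'I_r, i < j -> #[x i] %| b (i, j)) ->
  capable (nilpotent_product2 C).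
Proof.
move=> hgen y_gen H3 y_ord a_ord b_ord; exists H.
pose pi : group_hom H (quotient_group (center H)) := quotient_pi (center H).
have piZ h : center_set h <-> pi h = 1.
  by split=> [hZ|/quotient_pi_eq1 //]; apply/(quotient_pi_eq1 (center H)).
have pi_surj u : exists h, pi h = u by apply: quotient_pi_surj.
have Q2 : class_le2 (quotient_group (center H)).
  move=> u v w; have [a <-] := pi_surj u; have [b <-] := pi_surj v.
  have [c <-] := pi_surj w; rewrite -!gmulfR.
  by apply/piZ => d; apply/commgP; rewrite H3.
have [|f fE] := nilp_gen_lift hgen (k := fun i => pi (y i)) Q2.
  by move=> i; rewrite -gmulfXn; apply/piZ.
have f_surj v : exists u, f u = v.
  have [h <-] := pi_surj v.
  elim/y_gen: h => [|i h [u uE]]; first by exists 1; rewrite !gmulf1.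
  by exists (nilp_gen x i * u); rewrite !gmulfM fE uE.
have G2 := @nilp_class_le2 _ C.
have X_ord i : nilp_gen x i ^+ #[x i] = 1 by rewrite -gmulfXn expg_order gmulf1.
have f_inj : injective f.
  (* For a kernel element in normal form, the exponents [a] are settled first; then [gen_word y a]
     is central, so [comm_word y b] is central by itself and [b_ord] applies. *)
  apply: gmulf_inj => u.
  have [a [b ->]] := normal_form G2 (fun i => order_gt0 (x i)) X_ord
    (nilp_gen_generating hgen) u.
  rewrite gmulfM (hom_gen_word a fE) (hom_comm_word b fE).
  rewrite -(hom_gen_word (f := pi) a (fun=> erefl)).
  rewrite -(hom_comm_word (f := pi) b (fun=> erefl)).
  rewrite -gmulfM => /piZ abZ; have ha := a_ord a b abZ.
  have aZ : center_set (gen_word y a).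
    move=> h; apply/commute_sym/commute_prod => i _; have /dvdnP[k ->] := ha i.
    by rewrite mulnC expgnA; apply/commuteX/commute_sym/y_ord.
  have bZ : center_set (comm_word y b).
    have [_ ZM ZV] := center_subgroup H.
    by rewrite -(mulKg (gen_word y a) (comm_word y b)); apply: ZM => //;
      apply: ZV.
  rewrite /gen_word big1 => [|i _]; last first.
    by have /dvdnP[k ->] := ha i; rewrite mulnC expgnA X_ord expg1n.
  rewrite mul1g /comm_word big1 // => -[i j] /= ij.
  have /dvdnP[k ->] := b_ord b bZ i j ij.
  by rewrite mulnC -commXg_class2 // expgnA X_ord expg1n comm1g.
have [g gK] : {g | cancel g f}.
  by exists (fun v => projT1 (cid (f_surj v))) => v; case: cid.
by exists f, g => // u; apply: f_inj; rewrite gK.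
Qed.

(** * Sufficiency of the bound *)

Lemma Zp_natr_eq0 (n k : nat) : 1 < n -> (k%:R == 0 :> 'Z_n)%R = (n %| k).
Proof. by move=> n1; rewrite -val_eqE /= val_Zp_nat. Qed.

(** In Z/2^n the element 2^(n - e - 1) has additive order 2^(e + 1); it serves as [s] for M =
    2^e. *)
Lemma scaled_natr_eq0 n e k : e < n ->
  ((2 ^ (n - e.+1))%:R * k%:R = 0 :> 'Z_(2 ^ n))%R <-> (2 * 2 ^ e %| k).
Proof.
move=> en; have n_gt0 : 0 < n by apply: leq_trans en.
have dvdE : (2 ^ n %| 2 ^ (n - e.+1) * k) = (2 * 2 ^ e %| k).
  by rewrite -{1}(subnK en) expnD expnS dvdn_pmul2l ?expn_gt0.
rewrite -GRing.natrM -dvdE -Zp_natr_eq0; first exact: rwP eqP.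
by rewrite -{1}(expn0 2) ltn_exp2l.
Qed.

Section Sufficiency.
Variables (r : nat) (C : 'I_r -> finGroupType).
Variables (x : forall i, C i) (alpha : 'I_r -> nat).
Hypothesis (hgen : forall i, [set: C i]%SET = <[x i]>).
Hypothesis (hord : forall i, #[x i] = (2 ^ alpha i)%N).
Hypothesis (halpha1 : forall i, 1 <= alpha i).
Hypothesis (halpha : forall i j : 'I_r, i <= j -> alpha i <= alpha j).

Lemma capable_of_bound : 1 < r ->
    (forall i j : 'I_r, i.+2 = r -> j.+1 = r -> alpha j <= alpha i + 1) ->
  capable (nilpotent_product2 C).
Proof.
case: r C x alpha hgen hord halpha1 halpha =>
  [//|[//|n]] D z al Dgen ord al1 al_le _.
pose top : 'I_n.+2 := ord_max; pose sub : 'I_n.+2 := inord n.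
have sub_val : sub = n :> nat by rewrite inordK.
move=> /(_ sub top); rewrite sub_val => /(_ erefl erefl) al_top.
have al_max i : al i <= al top by apply/al_le/leq_ord.
(* The extra factor 2 in the modulus leaves room for an element of additive order [2 * 2 ^ al i] for
   every [i], including [top]. *)
pose m := (al top).+1; pose R : finComNzRingType := 'Z_(2 ^ m);
  pose T := poly_shift R.
pose o i := (2 ^ al i)%N.
pose K := {t : {ffun 'I_n.+2 -> T} |
  [forall i, forall j, t i ^+ o i * t j == t j * t i ^+ o i]}.
have [H [y [ev [y_gen evE ev_inj]]]] :=
  subdirect_group (fun (k : K) i => val k i).
have ev_pt (t : 'I_n.+2 -> T) : (forall i j, commute (t i ^+ o i) (t j)) ->
    exists f : group_hom H T, forall i, f (y i) = t i.
  move=> tC; have tP : [forall i, forall j,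
      finfun t i ^+ o i * finfun t j == finfun t j * finfun t i ^+ o i].
    by apply/forallP => i; apply/forallP => j; rewrite !ffunE; apply/eqP/tC.
  by exists (ev (Sub (finfun t) tP)) => i; rewrite evE SubK ffunE.
pose s e : R := ((2 ^ (m - e.+1))%:R)%R.
have sM e : e < m -> forall k, (s e * k%:R = 0)%R <-> (2 * 2 ^ e %| k).
  by move=> em k; apply: scaled_natr_eq0.
have even2 i : 2 %| 2 ^ al i by rewrite dvdn_exp // al1.
have al_m i : al i < m by rewrite ltnS.
have pair (i j : 'I_n.+2) : i < j -> exists f : group_hom H T,
    forall l, f (y l) = shift_pair (s (al i)) i j l.
  move=> ij; apply: ev_pt => l l';
    apply: (shift_pair_admissible (sM _ (al_m i))) => //.
  exact/dvdn_exp2l/al_le/ltnW.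
apply: (capable_of_generators Dgen y_gen) => [a b c d|i|a b abZ i|b bZ i j ij].
- by apply: ev_inj => k; rewrite !gmulfR poly_shift_class3.
- apply: (generating_central y_gen) => j; rewrite ord.
  apply/commgP/eqP/ev_inj => k.
  rewrite gmulfR gmulfXn !evE; apply/eqP/commgP/eqP.
  by have /forallP/(_ i)/forallP/(_ j) := valP k.
- have pair_dvd (k l : 'I_n.+2) : k < l -> (o k %| a k) /\ (o k %| a l).
    move=> kl; have [f fE] := pair k l kl.
    apply: (@shift_pair_detect _ _ _ (sM _ (al_m k)) _ k l a b) => [|l'];
      first by rewrite neq_ltn kl.
    by rewrite -(hom_gen_word a fE) -(hom_comm_word b fE) -fE -gmulfM;
      apply/gmulf_commute/abZ.
  (* An index below [top] is read off its pair with [top]. For [top] itself the pair with [sub]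
     gives divisibility by [o sub], enough if the last two exponents agree; otherwise [shift_top]
     supplies the missing factor 2. *)
  rewrite ord; have [->|i_top] := eqVneq i top; last first.
    have lt_i : i < top by rewrite ltn_neqAle i_top leq_ord.
    by have [] := pair_dvd i top lt_i.
  have lt_sub : sub < top by rewrite sub_val.
  have := al_le sub top (ltnW lt_sub); rewrite leq_eqVlt => /orP[/eqP e|lt_al].
    by rewrite -e; have [] := pair_dvd sub top lt_sub.
  have al_eq : al top = (al sub).+1 by apply/eqP;
    rewrite eqn_leq lt_al -addn1 al_top.
  have [|f fE] := ev_pt (shift_top (s (al sub)) sub top).
    by move=> l l'; apply: (shift_top_admissible (sM _ (al_m sub)));
      rewrite /o ?al_eq ?expnS.
  rewrite al_eq expnS.
  apply: (@shift_top_detect _ _ _ (sM _ (al_m sub)) (even2 sub) _ sub top a b).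
    by rewrite neq_ltn lt_sub.
  move=> l; rewrite -(hom_gen_word a fE) -(hom_comm_word b fE) -fE -gmulfM.
  exact/gmulf_commute/abZ.
rewrite ord; have [f fE] := pair i j ij.
apply: (shift_pair_detect_comm (sM _ (al_m i))) ij _ => l.
by rewrite -(hom_comm_word b fE) -fE; apply/gmulf_commute/bZ.
Qed.

End Sufficiency.

Local Close Scope quotient_scope.
Local Close Scope classical_set_scope.
Local Close Scope group_scope.

Theorem theorem5p2 (r : nat) (C : 'I_r -> finGroupType)
    (x : forall i : 'I_r, C i) (alpha : 'I_r -> nat)
    (hr : 0 < r)
    (hgen : forall i : 'I_r, [set: C i] = <[x i]>%g)
    (hord : forall i : 'I_r, #[x i]%g = 2 ^ alpha i)
    (halpha1 : forall i : 'I_r, 1 <= alpha i)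
    (halpha : forall i j : 'I_r, i <= j -> alpha i <= alpha j) :
  capable (nilpotent_product2 C) <->
  1 < r /\
  forall i j : 'I_r, i.+2 = r -> j.+1 = r -> alpha j <= alpha i + 1.
Proof.
split=> [|[r_gt1 bound]].
  exact: (capable_bound hgen hord halpha1 halpha hr).
exact: (capable_of_bound hgen hord halpha1 halpha r_gt1 bound).
Qed.
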